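(* Let $(P,d)$ be a metric space, let $\mathbb X$ and $\mathbb Y$ be normed spaces, let $f:P\times\mathbb X\to\mathbb Y$ be a mapping and $T:\mathbb X\rightrightarrows\mathbb Y$ a set-valued mapping, and let $$S_{f,T}(p)=\{x\in\mathbb X:\ \mathbf 0\in f(p,x)+T(x)\},\quad p\in P.$$ Let $\bar p\in P$ and $\bar x\in S_{f,T}(\bar p)$. Suppose that: (i) $T$ is single-valued near $\bar x$ and calm at $\bar x$, with modulus $\mathrm{clm}\,T(\bar x)$; (ii) $f(\cdot,x)$ is calm at $\bar p$, uniformly with respect to $x$ near $\bar x$, with (uniform) modulus $\mathrm{clm}\,f(\cdot,x)(\bar p)$; (iii) $\mathbb Y$ is partially ordered by a convex cone $\mathbb Y_+$ and the mapping $f(\bar p,\cdot)$ is $\mathbb Y_+$-convex; (iv) both conditions $$\mathbf 0^*\in\bigcup_{y^*\in\mathbb S^*\cap\mathbb Y^*_+}\mathrm{int}\,\partial(y^*\circ f(\bar p,\cdot))(\bar x)\qquad\text{and}\qquad\frac{\mathrm{clm}\,T(\bar x)}{\varrho(f(\bar p,\cdot))(\bar x)}<1$$ hold. Then $S_{f,T}:P\rightrightarrows\mathbb X$ has the isolated calmness property at $(\bar p,\bar x)$ and $$\mathrm{clm}\,S_{f,T}(\bar p,\bar x)\le\frac{\mathrm{clm}\,f(\cdot,x)(\bar p)}{\varrho(f(\bar p,\cdot))(\bar x)-\mathrm{clm}\,T(\bar x)}.$$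
   Context: $B(x,r)$ denotes the closed ball with center $x$ and radius $r$; $\mathbf 0$ is the null vector; $\mathrm{dist}(x,S)=\inf_{s\in S}d(x,s)$, with $\mathrm{dist}(x,\varnothing)=+\infty$. $\mathbb X^*,\mathbb Y^*$ are the topological duals, $\mathbf 0^*$ is the null vector of $\mathbb X^*$, $\mathbb B^*$ the closed unit ball of $\mathbb X^*$, $\mathbb S^*$ the unit sphere of $\mathbb Y^*$, $\mathrm{int}$ the norm interior in $\mathbb X^*$. The order on $\mathbb Y$ is $y_1\le_{\mathbb Y}y_2$ iff $y_2-y_1\in\mathbb Y_+$. A mapping $g:\mathbb X\to\mathbb Y$ is $\mathbb Y_+$-convex if $g(tx_1+(1-t)x_2)\le_{\mathbb Y}tg(x_1)+(1-t)g(x_2)$ for all $t\in[0,1]$, $x_1,x_2\in\mathbb X$. $\mathbb Y^*_+=\{y^*\in\mathbb Y^*:\langle y^*,y\rangle\ge0,\ \forall y\in\mathbb Y_+\}$. $(y^*\circ g)(x)=\langle y^*,g(x)\rangle$, and $\partial$ is the subdifferential of convex analysis. For $g:\mathbb X\to\mathbb Y$, $$\varrho(g)(\bar x)=\sup\{\rho>0:\ \rho\mathbb B^*\subseteq\partial(y^*\circ g)(\bar x)\text{ for some }y^*\in\mathbb S^*\cap\mathbb Y^*_+\}.$$ A mapping $g$ that is single-valued near $\bar x$ is calm at $\bar x$ if there exist $\kappa\ge0$, $r>0$ such that $d(g(x),g(\bar x))\le\kappa\,d(x,\bar x)$ for all $x\in B(\bar x,r)$; $\mathrm{clm}\,g(\bar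 x)$ is the infimum of all such $\kappa$. That $f(\cdot,x)$ is calm at $\bar p$ uniformly with respect to $x$ near $\bar x$ means that there exist $\kappa\ge0$ and $r>0$ such that $\|f(p,x)-f(\bar p,x)\|\le\kappa\,d(p,\bar p)$ for all $p\in B(\bar p,r)$ and all $x\in B(\bar x,r)$; here $\mathrm{clm}\,f(\cdot,x)(\bar p)$ denotes the infimum of all such $\kappa$ (a single number, not depending on $x$). A set-valued mapping $G:X\rightrightarrows Y$ between metric spaces is calm at $(\bar x,\bar y)\in\mathrm{graph}\,G$ if there exist $\kappa\ge0$, $r>0$ such that $$\sup_{y\in G(x)\cap B(\bar y,r)}\mathrm{dist}(y,G(\bar x))\le\kappa\,d(x,\bar x),\quad\forall x\in B(\bar x,r)$$ (a supremum over the empty set imposing no condition); $\mathrm{clm}\,G(\bar x,\bar y)$ is the infimum of all $\kappa\ge0$ for which such an $r$ exists. $G$ has the isolated calmness property at $(\bar x,\bar y)$ if it is calm at $(\bar x,\bar y)$ and $\bar y$ is an isolated point of $G(\bar x)$. *)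

(* Defs.v *)
From HB Require Import structures.
From mathcomp Require Import all_boot all_order all_algebra.
From mathcomp Require Import all_classical all_reals all_analysis.

Set Implicit Arguments.
Unset Strict Implicit.
Unset Printing Implicit Defensive.

Import Order.TTheory GRing.Theory Num.Theory.
Import numFieldNormedType.Exports.

Local Open Scope classical_set_scope.
Local Open Scope ring_scope.

(* Balls are written out as closed balls: the library's [closed_ball] is the
   closure of an open ball, which may be smaller in a general metric space. *)

Section dual_space.
Context {R : realType} {V : normedModType R}.
Implicit Types (l : {linear V -> R^o}) (phi : V -> R).

Definition dual : set {linear V -> R^o} := [set l | continuous l].

(* Meaningful on [dual], where the set below is bounded; it contains 0. *)
Definition dual_norm (l : V -> R) : R :=
  sup [set `|l x| | x in [set x : V | `|x| <= 1]].

Definition dual_unit_ball : set {linear V -> R^o} :=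
  dual `&` [set l | dual_norm l <= 1].

Definition dual_unit_sphere : set {linear V -> R^o} :=
  dual `&` [set l | dual_norm l = 1].

Definition dual_interior (A : set {linear V -> R^o}) : set {linear V -> R^o} :=
  dual `&` [set l | exists2 e : R, 0 < e &
    forall l', dual l' -> dual_norm (l' \- l) < e -> A l'].

Definition dual_cone (C : set V) : set {linear V -> R^o} :=
  dual `&` [set l | forall y, C y -> 0 <= l y].

Definition subdifferential phi (x0 : V) : set {linear V -> R^o} :=
  dual `&` [set l | forall x, l (x - x0) <= phi x - phi x0].

Definition dist_set (x : V) (A : set V) : \bar R :=
  ereal_inf [set `|x - s|%:E | s in A].

End dual_space.

Section cone_order.
Context {R : realType} {X Y : normedModType R}.

(* The induced order is reflexive and transitive; it is antisymmetric exactly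
   when [C] is pointed, which is not required. *)
Definition convex_cone (C : set Y) : Prop :=
  [/\ C 0, (forall (t : R) y, 0 < t -> C y -> C (t *: y))
    & convex_set (C : set (convex_lmodType Y))].

Definition cone_le (C : set Y) (y1 y2 : Y) : Prop := C (y2 - y1).

Definition cone_convex (C : set Y) (g : X -> Y) : Prop :=
  forall (t : R) x1 x2, 0 <= t <= 1 ->
    cone_le C (g (t *: x1 + (1 - t) *: x2)) (t *: g x1 + (1 - t) *: g x2).

Definition varrho (C : set Y) (g : X -> Y) (x0 : X) : \bar R :=
  ereal_sup [set rho%:E | rho in [set rho : R | 0 < rho /\
    exists2 ys : {linear Y -> R^o}, (dual_unit_sphere `&` dual_cone C) ys &
      [set (rho \*: l : {linear X -> R^o}) | l in dual_unit_ball]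
        `<=` subdifferential (ys \o g) x0]].

End cone_order.

Section single_valued_calmness.
Context {R : realType} {X Y : normedModType R}.
Implicit Types T : X -> set Y.

Definition single_valued_near T (x0 : X) : Prop :=
  \forall x \near x0, exists y, T x = [set y].

(* Meant for [T] single-valued near [x0]; [r] may be shrunk so that the
   quantifiers over [y] and [y0] only see the values of [T] at [x] and [x0]. *)
Definition sv_calm_const T (x0 : X) : set R :=
  [set k | 0 <= k /\ exists2 r : R, 0 < r &
    forall x, `|x - x0| <= r -> forall y y0, T x y -> T x0 y0 ->
      `|y - y0| <= k * `|x - x0|].

Definition sv_calm T (x0 : X) : Prop := sv_calm_const T x0 !=set0.

Definition sv_clm T (x0 : X) : \bar R :=
  ereal_inf [set k%:E | k in sv_calm_const T x0].

End single_valued_calmness.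

Section parametric_calmness.
Context {R : realType} {P : metricType R} {X Y : normedModType R}.
Implicit Types (f : P -> X -> Y) (T : X -> set Y) (G : P -> set X).

Definition unif_calm_const f (p0 : P) (x0 : X) : set R :=
  [set k | 0 <= k /\ exists2 r : R, 0 < r &
    forall p x, mdist p p0 <= r -> `|x - x0| <= r ->
      `|f p x - f p0 x| <= k * mdist p p0].

Definition unif_calm f (p0 : P) (x0 : X) : Prop :=
  unif_calm_const f p0 x0 !=set0.

Definition unif_clm f (p0 : P) (x0 : X) : \bar R :=
  ereal_inf [set k%:E | k in unif_calm_const f p0 x0].

(* [ereal_sup set0 = -oo], so the bound is void when [G p] misses the ball. *)
Definition calm_const G (p0 : P) (x0 : X) : set R :=
  [set k | 0 <= k /\ exists2 r : R, 0 < r &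
    forall p, mdist p p0 <= r ->
      (ereal_sup [set dist_set x (G p0) |
         x in G p `&` [set x : X | (`|x - x0| <= r)%R]] <= (k * mdist p p0)%:E)%E].

Definition calm G (p0 : P) (x0 : X) : Prop :=
  G p0 x0 /\ calm_const G p0 x0 !=set0.

Definition clm G (p0 : P) (x0 : X) : \bar R :=
  ereal_inf [set k%:E | k in calm_const G p0 x0].

Definition isolated_calmness G (p0 : P) (x0 : X) : Prop :=
  calm G p0 x0 /\ isolated (G p0) x0.

Definition solution_map f T (p : P) : set X :=
  [set x | [set f p x + y | y in T x] 0].

End parametric_calmness.

(* Main.v *)
Require Import Defs.
From HB Require Import structures.
From mathcomp Require Import all_boot all_order all_algebra.
From mathcomp Require Import all_classical all_reals all_analysis.
From mathcomp Require Import lra.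

Set Implicit Arguments.
Unset Strict Implicit.
Unset Printing Implicit Defensive.

Import Order.TTheory GRing.Theory Num.Theory.
Import numFieldNormedType.Exports.

Local Open Scope classical_set_scope.
Local Open Scope ring_scope.

(** The modulus [varrho] measures how fast [f pbar] moves away from its value
    at [xbar].  If [rho] times the dual unit ball lies in the subdifferential
    of [ys \o f pbar] at [xbar], then testing the subgradient inequality
    against a functional of norm at most 1 that attains the norm of [x - xbar]
    gives [rho * |x - xbar| <= ys (f pbar x) - ys (f pbar xbar)], and since
    [ys] has norm 1 the right-hand side is at most
    [|f pbar x - f pbar xbar|] ([varrho_expansion]).  So [f pbar] expands
    distances to [xbar] by any factor [rho < varrho], globally.

    The perturbations are weaker than this expansion.  For [x] near [xbar] with
    [0 = f p x + y] and [y] in [T x], the triangle inequality bounds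
    [f pbar x - f pbar xbar] by the sum of [f pbar x - f p x] and of the
    variation of [T], hence by [k' * d(p, pbar) + k * |x - xbar|] for constants
    of calmness [k'] of [f] and [k] of [T].  When [k < rho] this reads
    [|x - xbar| <= k' / (rho - k) * d(p, pbar)] ([solution_map_estimate]).
    Taking [p = pbar] shows that [xbar] is an isolated solution, and letting
    [rho], [k], [k'] tend to their extremal values gives the bound on the
    modulus.

    The existence of norm-attaining functionals ([norming_functional]) is a
    consequence of the Hahn-Banach theorem, which is proved through minimal
    sublinear functionals: these exist below any sublinear functional by Zorn's
    lemma, and they are linear because [tilt] would strictly lower them
    otherwise ([sublinear_linear_minorant]). *)

(** * Sublinear functionals and their linear minorants *)

Section sublinear_functionals.
Context {R : realType} {V : lmodType R}.
Implicit Types (p q : V -> R) (x y : V).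

Definition sublinear q : Prop :=
  (forall x y, q (x + y) <= q x + q y) /\
  (forall (t : R) x, 0 < t -> q (t *: x) <= t * q x).

Lemma sublinear0 q : sublinear q -> q 0 = 0.
Proof.
move=> [qD qZ]; have := qD 0 0; have := qZ (2^-1) 0.
rewrite addr0 scaler0 invr_gt0 ltr0n => /(_ isT); lra.
Qed.

Lemma sublinearZ q (t : R) x : sublinear q -> 0 <= t -> q (t *: x) = t * q x.
Proof.
move=> sq; rewrite le_eqVlt => /predU1P[<-|t0].
  by rewrite scale0r mul0r sublinear0.
apply/eqP; rewrite eq_le sq.2//= -ler_pdivlMl//.
by rewrite -[in leLHS](scalerK (lt0r_neq0 t0) x) sq.2// invr_gt0.
Qed.

Lemma sublinear_geN q x : sublinear q -> - q (- x) <= q x.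
Proof.
by move=> sq; have := sq.1 x (- x); rewrite subrr sublinear0//; lra.
Qed.

(** [tilt q y] is the largest sublinear functional below [q] whose value at
    [- y] is at most [- q y]; it thus forces [q] to be odd in the direction [y]. *)
Definition tilt_values q y x : set R :=
  [set q (x + t *: y) - t * q y | t in [set t : R | 0 <= t]].

Definition tilt q y x : R := inf (tilt_values q y x).

Lemma tilt_values_lb q y x :
  sublinear q -> lbound (tilt_values q y x) (- q (- x)).
Proof.
move=> sq _ [t /= t0 <-]; rewrite -sublinearZ//.
by have := sq.1 (x + t *: y) (- x); rewrite addrAC subrr add0r; lra.
Qed.

Lemma tilt_le q y x (t : R) :
  sublinear q -> 0 <= t -> tilt q y x <= q (x + t *: y) - t * q y.
Proof.
move=> sq t0; apply: ge_inf; last by exists t.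
by exists (- q (- x)); exact: tilt_values_lb.
Qed.

Lemma le_tilt q y x (a : R) :
  (forall t : R, 0 <= t -> a <= q (x + t *: y) - t * q y) -> a <= tilt q y x.
Proof.
move=> h; apply: lb_le_inf; last by move=> _ [t /= t0 <-]; exact: h.
by exists (q (x + 0 *: y) - 0 * q y); exists 0 => //=.
Qed.

Lemma tilt_le_self q y x : sublinear q -> tilt q y x <= q x.
Proof.
by move=> sq; have := tilt_le y x sq (lexx 0); rewrite scale0r addr0 mul0r subr0.
Qed.

Lemma sublinear_tilt q y : sublinear q -> sublinear (tilt q y).
Proof.
move=> sq; split=> [x1 x2|c x c0].
  rewrite -lerBlDr; apply: le_tilt => s s0.
  rewrite lerBlDr -lerBlDl; apply: le_tilt => t t0.
  have := tilt_le y (x1 + x2) sq (addr_ge0 s0 t0).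
  have := sq.1 (x1 + s *: y) (x2 + t *: y).
  by rewrite addrACA -scalerDl; lra.
rewrite -ler_pdivrMl//; apply: le_tilt => t t0.
rewrite ler_pdivrMl//; have := tilt_le y (c *: x) sq (mulr_ge0 (ltW c0) t0).
rewrite -scalerA -scalerDr (sublinearZ _ sq); last exact: ltW.
by rewrite mulrBr mulrA.
Qed.

(** A minimal sublinear functional [q] equals [tilt q y] for every [y];
    evaluating the infimum in [tilt] at [t = 1] gives
    [q x <= q (x + y) - q y], so that [q] is additive, hence linear. *)
Lemma sublinear_linear_minorant p : sublinear p ->
  exists l : {linear V -> R^o}, forall x, l x <= p x.
Proof.
move=> sp.
pose T := {q : V -> R | sublinear q /\ forall x, q x <= p x}.
pose le (q1 q2 : T) : bool := `[< forall x, sval q2 x <= sval q1 x >].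
have [||q1 q2 /asboolP q21 /asboolP q12||[q [sq qp]] qmin] := @Zorn T le.
- by move=> q; apply/asboolP.
- move=> q1 q2 q3 /asboolP q21 /asboolP q32; apply/asboolP => x.
  exact: le_trans (q32 x) (q21 x).
- case: q1 q2 q21 q12 => [q1 H1] [q2 H2] /= q21 q12; apply: eq_exist.
  by apply/funext => x; apply/eqP; rewrite eq_le q12 q21.
- move=> A Atot; have [[q0 Aq0]|A0] := pselect (A !=set0); last first.
    exists (exist _ p (conj sp (fun x => lexx (p x)))) => s As.
    by exfalso; apply: A0; exists s.
  (* A chain is bounded below by its pointwise infimum, which is finite since
     every sublinear functional below [p] is at least [- p (- x)] at [x]. *)
  pose m x := inf [set sval h x | h in A].
  have mle (q : T) x : A q -> m x <= sval q x.
    move=> Aq; apply: ge_inf; last by exists q.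
    exists (- p (- x)) => _ [[q' [sq' q'p]] _ <-] /=.
    by apply: le_trans (sublinear_geN x sq'); rewrite lerN2.
  have lem a x : (forall q : T, A q -> a <= sval q x) -> a <= m x.
    move=> h; apply: lb_le_inf; first by exists (sval q0 x); exists q0.
    by move=> _ [q Aq <-]; exact: h.
  have sm : sublinear m.
    split=> [x y|t x t0].
      rewrite -lerBlDr; apply: (lem _ x) => q1 Aq1.
      rewrite lerBlDr -lerBlDl; apply: (lem _ y) => q2 Aq2; rewrite lerBlDl.
      (* the smaller of [q1] and [q2] bounds [m] at [x + y] *)
      have [/asboolP q21|/asboolP q12] := Atot _ _ Aq1 Aq2.
        apply: le_trans (mle _ _ Aq2) _.
        by apply: le_trans ((svalP q2).1.1 _ _) _; rewrite lerD2r.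
      apply: le_trans (mle _ _ Aq1) _.
      by apply: le_trans ((svalP q1).1.1 _ _) _; rewrite lerD2l.
    rewrite -ler_pdivrMl//; apply: lem => q Aq; rewrite ler_pdivrMl//.
    by apply: le_trans (mle _ _ Aq) _; exact: (svalP q).1.2.
  have mp x : m x <= p x by apply: le_trans (mle q0 x Aq0) ((svalP q0).2 x).
  by exists (exist _ m (conj sm mp)) => s As; apply/asboolP => x /=; exact: mle.
have tiltE y : tilt q y = q.
  have tp x : tilt q y x <= p x by apply: le_trans (tilt_le_self _ _ sq) (qp x).
  pose s : T := exist _ (tilt q y) (conj (sublinear_tilt y sq) tp).
  apply: (congr1 sval (qmin s _)).
  by apply/asboolP => x /=; exact: tilt_le_self.
have qD x y : q (x + y) = q x + q y.
  apply/eqP; rewrite eq_le sq.1 /=.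
  by have := tilt_le y x sq ler01; rewrite tiltE scale1r mul1r; lra.
have qN x : q (- x) = - q x.
  by have := qD x (- x); rewrite subrr sublinear0//; lra.
have qlin : linear (q : V -> R^o).
  move=> t x y; rewrite qD; congr (_ + _).
  have [t0|t0] := lerP 0 t; first exact: sublinearZ.
  rewrite -[t]opprK scaleNr qN sublinearZ ?oppr_ge0 1?ltW//.
  by rewrite scaleNr.
pose lin := GRing.isLinear.Build R V R^o *:%R (q : V -> R^o) qlin.
pose l : {linear V -> R^o} := HB.pack (q : V -> R^o) lin.
by exists l => x; exact: qp.
Qed.

End sublinear_functionals.

(** * Norms of continuous linear functionals *)

Section dual_norm.
Context {R : realType} {V : normedModType R}.
Implicit Types l : {linear V -> R^o}.

Lemma dual_norm_le (l : V -> R) (c : R) : 0 <= c ->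
  (forall x, `|l x| <= c * `|x|) -> dual_norm l <= c.
Proof.
move=> c0 lc; apply: ge_sup.
  by exists `|l 0|; exists 0 => //=; rewrite normr0.
by move=> _ [x /= x1 <-]; apply: le_trans (lc x) _; exact: ler_piMr.
Qed.

(** Continuity makes the supremum that defines [dual_norm] a genuine one, so the
    bound on the unit ball extends to [x] by scaling. *)
Lemma dual_norm_ge l x : dual l -> `|l x| <= dual_norm l * `|x|.
Proof.
move=> lc.
have [|B [Breal lB]] := (linear_boundedP l).1.
  by apply: continuous_linear_bounded; exact: lc.
have {}lB : forall x : V, `|l x| <= (B + 1) * `|x|.
  by apply: lB; rewrite ltrDl.
have [->|x0] := eqVneq x 0; first by rewrite linear0 !normr0 mulr0.
have nx : 0 < `|x| by rewrite normr_gt0.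
rewrite -ler_pdivrMr//.
have -> : `|l x| / `|x| = `|l (`|x|^-1 *: x)|.
  by rewrite linearZ /= normrM normfV normr_id mulrC.
apply: ub_le_sup; last first.
  by exists (`|x|^-1 *: x) => //=; rewrite normrZ normfV normr_id mulVf ?gt_eqF.
exists (Num.max 0 (B + 1)) => _ [z /= z1 <-]; apply: le_trans (lB z) _.
rewrite le_max; have [B0|B0] := lerP 0 (B + 1).
  by rewrite ler_piMr ?orbT.
by rewrite mulr_le0_ge0// ltW.
Qed.

Lemma bounded_dual l (c : R) : (forall x, `|l x| <= c * `|x|) -> dual l.
Proof.
move=> lc; apply: bounded_linear_continuous; apply/linear_boundedP.
exists c; split=> [|r cr x]; first exact: num_real.
by apply: le_trans (lc x) _; rewrite ler_wpM2r// ltW.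
Qed.

Lemma linear_le_norm l : (forall x, l x <= `|x|) -> dual_unit_ball l.
Proof.
move=> ln.
have lN x : `|l x| <= `|x|.
  by rewrite ler_norml ln andbT lerNl -linearN /=; have := ln (- x); rewrite normrN.
have l1 x : `|l x| <= 1 * `|x| by rewrite mul1r.
by split; [exact: bounded_dual l1|exact: dual_norm_le].
Qed.

(** Among the linear functionals below the norm, those below its tilt along [x]
    satisfy [l (- x) <= - |x|], that is [|x| <= l x]. *)
Lemma norming_functional (x : V) :
  exists2 l : {linear V -> R^o}, dual_unit_ball l & l x = `|x|.
Proof.
have sn : sublinear (fun v : V => `|v|).
  by split=> [u v|t v t0]; [exact: ler_normD|rewrite normrZ gtr0_norm].
have [l lt] := sublinear_linear_minorant (sublinear_tilt x sn).
have ln v : l v <= `|v| by apply: le_trans (lt v) _; exact: tilt_le_self.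
exists l; first exact: linear_le_norm.
apply/eqP; rewrite eq_le ln /= -lerN2 -linearN /=.
apply: le_trans (lt (- x)) _; have := tilt_le x (- x) sn ler01.
by rewrite scale1r addNr normr0 mul1r sub0r.
Qed.

End dual_norm.

(** * Infima of sets of nonnegative constants *)

(** All the calmness moduli are infima of this form. *)
Lemma ereal_inf_nonneg {R : realType} (A : set R) :
  A !=set0 -> (forall k, A k -> 0 <= k) ->
  exists c : R, [/\ ereal_inf [set k%:E | k in A] = c%:E, 0 <= c &
    forall e, 0 < e -> exists2 k, A k & k < c + e].
Proof.
move=> [k0 Ak0] A0; set m := ereal_inf _.
have m0 : (0 <= m)%E by apply/ereal_infP => _ [k Ak <-]; rewrite lee_fin A0.
have mk : (m <= k0%:E)%E by apply: ge_ereal_inf; exists k0%:E => //; exists k0.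
have mfin : m \is a fin_num.
  by rewrite fin_numElt (lt_le_trans _ m0)//= (le_lt_trans mk)// ltry.
exists (fine m); rewrite fineK//; split=> //; first exact: fine_ge0.
move=> e e0; have /ereal_inf_ltP[_ [k Ak <-] ke] : (m < m + e%:E)%E.
  by rewrite lteDl// lte_fin.
by exists k => //; rewrite -lte_fin EFinD fineK.
Qed.

(** * The modulus [varrho] as a rate of expansion *)

Section varrho.
Context {R : realType} {X Y : normedModType R}.
Implicit Types (g : X -> Y) (C : set Y) (x : X).

(** The subgradient inequality is applied to [rho] times a functional that
    attains the norm of [x - x0]. *)
Lemma subdifferential_ball_growth (phi : X -> R) (x0 : X) (rho : R) :
  [set (rho \*: l : {linear X -> R^o}) | l in dual_unit_ball]
    `<=` subdifferential phi x0 ->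
  forall x, rho * `|x - x0| <= phi x - phi x0.
Proof.
move=> sub x; have [l lB <-] := norming_functional (x - x0).
by have [_ /(_ x)] := sub _ (ex_intro2 _ _ l lB erefl).
Qed.

Lemma varrho_expansion C g (x0 : X) (c : R) : (c%:E < varrho C g x0)%E ->
  exists2 rho : R, c < rho & forall x, rho * `|x - x0| <= `|g x - g x0|.
Proof.
move=> /ereal_sup_gtP[_ [rho [_ [ys [[ysd ys1] _] sub]] <-]].
rewrite lte_fin => crho; exists rho => // x.
apply: le_trans (subdifferential_ball_growth sub x) _ => /=.
rewrite -linearB; apply: le_trans (ler_norm _) _.
by apply: le_trans (dual_norm_ge _ ysd) _; rewrite ys1 mul1r.
Qed.

(** A dual ball of radius [e / 2] lies in any set containing the open dual ball
    of radius [e], so an interior zero subgradient yields a positive radius. *)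
Lemma varrho_gt0 C g (x0 : X) :
  (\bigcup_(ys in (dual_unit_sphere `&` dual_cone C))
     dual_interior (subdifferential (ys \o g) x0))
    (\0 : {linear X -> R^o}) ->
  (0 < varrho C g x0)%E.
Proof.
move=> [ys hys [_ [e e0 he]]]; apply/ereal_sup_gtP.
have e20 : 0 < e / 2 by rewrite divr_gt0.
exists (e / 2)%:E; last by rewrite lte_fin.
exists (e / 2) => //; split=> //; exists ys => // _ [l [lc l1] <-].
have rle x : `|(e / 2 *: l x : R^o)| <= e / 2 * `|x|.
  rewrite normrZ gtr0_norm// ler_pM2l//.
  apply: le_trans (dual_norm_ge x lc) _.
  by rewrite ler_piMl.
apply: he.
  exact: (@bounded_dual R X (e / 2 \*: l : {linear X -> R^o}) (e / 2)).
apply: le_lt_trans (_ : e / 2 < e); last by lra.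
apply: dual_norm_le; first exact: ltW.
by move=> x; rewrite /= subr0.
Qed.

End varrho.

(** * Calmness of the solution map *)

Section solution_map_calmness.
Context {R : realType} {P : metricType R} {X Y : normedModType R}.
Context (f : P -> X -> Y) (T : X -> set Y) (p0 : P) (x0 : X).

(** Expansion of [f p0] at rate [rho] against perturbations of rates [k]
    (from [T]) and [k'] (from the parameter): solutions near [x0] stay within
    [k' / (rho - k)] times the parameter distance when [k < rho]. *)
Lemma solution_map_estimate (k k' rho : R) :
  solution_map f T p0 x0 -> sv_calm_const T x0 k -> unif_calm_const f p0 x0 k' ->
  (forall x, rho * `|x - x0| <= `|f p0 x - f p0 x0|) ->
  exists2 r : R, 0 < r & forall p x, mdist p p0 <= r -> `|x - x0| <= r ->
    solution_map f T p x -> (rho - k) * `|x - x0| <= k' * mdist p p0.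
Proof.
move=> [y0 Ty0 fy0] [_ [r1 r10 hT]] [_ [r2 r20 hf]] hrho.
exists (Num.min r1 r2) => [|p x]; first by rewrite lt_min r10.
rewrite !le_min => /andP[_ pr2] /andP[xr1 xr2] [y Ty fy].
have dT := hT _ xr1 _ _ Ty Ty0.
have df := hf _ _ pr2 xr2.
have fpE : f p x = - y by apply/eqP; rewrite -addr_eq0 fy.
have f0E : f p0 x0 = - y0 by apply/eqP; rewrite -addr_eq0 fy0.
have : `|f p0 x - f p0 x0| <= `|f p x - f p0 x| + `|y - y0|.
  apply: le_trans (ler_distD (f p x) _ _) _.
  by rewrite distrC lerD2l fpE f0E opprK addrC distrC.
by have := hrho x; lra.
Qed.

(** The distance of a nearby solution to [solution_map f T p0] is at most its
    distance to the solution [x0]. *)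
Lemma solution_map_calm_const (k k' rho : R) :
  solution_map f T p0 x0 -> sv_calm_const T x0 k -> unif_calm_const f p0 x0 k' ->
  (forall x, rho * `|x - x0| <= `|f p0 x - f p0 x0|) -> k < rho ->
  calm_const (solution_map f T) p0 x0 (k' / (rho - k)).
Proof.
move=> hx hk hk' hrho krho.
have [r r0 est] := solution_map_estimate hx hk hk' hrho.
have rk : 0 < rho - k by rewrite subr_gt0.
split; first by rewrite divr_ge0 ?hk'.1// ltW.
exists r => // p pr; apply/ereal_supP => _ [x [Sx xr] <-].
apply: ge_ereal_inf; exists `|x - x0|%:E; first by exists x0.
by rewrite lee_fin mulrAC ler_pdivlMr// mulrC est.
Qed.

(** At [p = p0] the estimate becomes [(rho - k) * |x - x0| <= 0]. *)
Lemma solution_map_isolated (k k' rho : R) :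
  solution_map f T p0 x0 -> sv_calm_const T x0 k -> unif_calm_const f p0 x0 k' ->
  (forall x, rho * `|x - x0| <= `|f p0 x - f p0 x0|) -> k < rho ->
  isolated (solution_map f T p0) x0.
Proof.
move=> hx hk hk' hrho krho.
have [r r0 est] := solution_map_estimate hx hk hk' hrho.
split; first exact: mem_set.
exists (ball x0 r); first exact: nbhsx_ballx.
apply/seteqP; split=> [x [xr Sx]|x ->] /=; last by split=> //; exact: ballxx.
move: xr; rewrite -ball_normE /= distrC => /ltW xr.
have := est p0 x; rewrite mdistxx mulr0 => /(_ (ltW r0) xr Sx).
by rewrite pmulr_rle0 ?subr_gt0// normr_le0 subr_eq0 => /eqP.
Qed.

End solution_map_calmness.

(** * Passing to the limit in the moduli *)

Lemma lte_of_div_lt1 {R : realType} (c : R) (v : \bar R) :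
  (0 < v)%E -> (c%:E / v < 1)%E -> (c%:E < v)%E.
Proof.
case: v => [v| |]; [|by move=> *; exact: ltry|by rewrite ltNge leNye].
rewrite lte_fin => v0; rewrite inver gt_eqF// -EFinM !lte_fin.
by rewrite ltr_pdivrMr// mul1r.
Qed.

Lemma ler_of_approx {R : realFieldType} (a b m d : R) : 0 <= m -> 0 < d ->
  (forall e, 0 < e < d -> a <= b + m * e) -> a <= b.
Proof.
move=> m0 d0 h; rewrite leNgt; apply/negP => ba.
have D0 : 0 < a - b by rewrite subr_gt0.
have m1 : 0 < m + 1 by lra.
pose e0 := (a - b) / (m + 1); have e00 : 0 < e0 by rewrite divr_gt0.
have me0 : (m + 1) * e0 = a - b by rewrite mulrC divfK// gt_eqF.
pose e := Num.min e0 (d / 2).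
have e1 : e <= e0 by rewrite ge_min lexx.
have e2 : e <= d / 2 by rewrite ge_min lexx orbT.
have e3 : 0 < e by rewrite lt_min e00 divr_gt0.
have : a <= b + m * e by apply: h; rewrite e3; lra.
have := ler_wpM2l m0 e1; lra.
Qed.

Theorem theorem9 (R : realType) (P : metricType R) (X Y : normedModType R)
  (f : P -> X -> Y) (T : X -> set Y) (Yp : set Y) (pbar : P) (xbar : X)
  (hx : solution_map f T pbar xbar)
  (hT1 : single_valued_near T xbar)
  (hT2 : sv_calm T xbar)
  (hf : unif_calm f pbar xbar)
  (hY : convex_cone Yp)
  (hconv : cone_convex Yp (f pbar))
  (hint : (\bigcup_(ys in (dual_unit_sphere `&` dual_cone Yp))
             dual_interior (subdifferential (ys \o f pbar) xbar))
          (\0 : {linear X -> R^o}))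
  (hlt : (sv_clm T xbar / varrho Yp (f pbar) xbar < 1)%E) :
  isolated_calmness (solution_map f T) pbar xbar /\
  (clm (solution_map f T) pbar xbar <=
     unif_clm f pbar xbar / (varrho Yp (f pbar) xbar - sv_clm T xbar))%E.
Proof.
have [c [cE c0 capx]] := ereal_inf_nonneg hT2 (fun k hk => proj1 hk).
have [u [uE u0 uapx]] := ereal_inf_nonneg hf (fun k hk => proj1 hk).
move: hlt; rewrite /sv_clm /unif_clm cE uE.
have := @varrho_expansion _ _ _ Yp (f pbar) xbar.
have := varrho_gt0 hint.
set v := varrho _ _ _ => v0 expansion /(lte_of_div_lt1 v0) cv.
have [rho crho hrho] := expansion _ cv.
have [k hk krho] := capx _ (ltac:(by rewrite subr_gt0) : 0 < rho - c).
have {}krho : k < rho by lra.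
have [k' hk' _] := uapx _ ltr01.
have Scalm := solution_map_calm_const hx hk hk' hrho krho.
split.
  split; last exact: solution_map_isolated hx hk hk' hrho krho.
  by split => //; exists (k' / (rho - k)).
have [s [sE s0 _]] := ereal_inf_nonneg (ex_intro _ _ Scalm) (fun k hk => proj1 hk).
(* The limit in [k] and [k'] is taken first, for a fixed real [w] below [v];
   the limit in [w] then treats finite and infinite [v] separately. *)
have bound w : c < w -> (w%:E < v)%E -> s * (w - c) <= u.
  move=> cw wv; have [sig wsig hsig] := expansion _ wv.
  apply: (@ler_of_approx _ _ _ (s + 1) (w - c)) => [||e /andP[e0 ew]]; try lra.
  have [l hl le] := capx _ e0; have [l' hl' le'] := uapx _ e0.
  have lsig : l < sig by lra.
  have : s <= l' / (sig - l).
    rewrite -lee_fin -sE; apply: ge_ereal_inf; exists (l' / (sig - l))%:E => //.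
    by exists (l' / (sig - l)) => //; exact: solution_map_calm_const.
  rewrite ler_pdivlMr ?subr_gt0// => ssl.
  have : s * (w - c - e) <= s * (sig - l) by rewrite ler_wpM2l//; lra.
  lra.
rewrite /clm sE; case: v cv bound {v0 expansion} => [v||]//.
- rewrite lte_fin => cv bound.
  rewrite -EFinB inver gt_eqF ?subr_gt0// -EFinM lee_fin ler_pdivlMr ?subr_gt0//.
  apply: (@ler_of_approx _ _ _ s (v - c)) => // [|e /andP[e0 ev]]; first by rewrite subr_gt0.
  have := bound (v - e); rewrite lte_fin => /(_ ltac:(lra) ltac:(lra)).
  lra.
- move=> _ bound; rewrite addye// invey mule0 lee_fin leNgt; apply/negP => sp.
  (* At this point [w], the bound would read [u + 1 <= u]. *)
  have := bound (c + (u + 1) / s); rewrite ltry ltrDl divr_gt0//; last lra.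
  move=> /(_ isT isT); rewrite addrC addKr mulrC divfK ?gt_eqF//; lra.
Qed.
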